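(* Let $c\ne0$ be real and let $\mathbf{J}\colon T\mathcal{M}\to\mathfrak{X}(M)'$ be given by $\langle\mathbf{J}(g,k),X\rangle=G^{c}_g(k,\mathrm{L}_Xg)$. For all $\varphi\in\operatorname{Diff}(M)$, $X\in\mathfrak{X}(M)$ and $(g,k)\in T\mathcal{M}$, $$\bigl\langle\mathbf{J}(\varphi^{*}g,\varphi^{*}k),\,X\bigr\rangle=\bigl\langle\mathbf{J}(g,k),\,\varphi_{*}X\bigr\rangle.$$ Thus $\mathbf{J}$ is equivariant for the pullback action on $T\mathcal{M}$ and the (co)adjoint type action $X\mapsto\varphi_*X$ on $\mathfrak{X}(M)$.
   Context: $M$ is a compact connected smooth manifold without boundary, $\dim M=n\ge2$. $S^2(M)$ is the Fréchet space of smooth symmetric $(0,2)$-tensor fields on $M$, and $\mathcal{M}\subset S^2(M)$ is the open cone of Riemannian metrics, with $T\mathcal{M}=\mathcal{M}\times S^2(M)$. $\mathfrak{X}(M)$ is the space of smooth vector fields, $\mathfrak{X}(M)'$ its continuous dual, $\operatorname{Diff}(M)$ the diffeomorphism group, $\mathrm{L}_X$ the Lie derivative, $\varphi_*X$ the pushforward of $X$, and $\mu_g$ the Riemannian volume density. With $\operatorname{tr}_gh=\operatorname{tr}(g^{-1}h)$ and $h_0=h-\frac1n(\operatorname{tr}_gh)g$, $G^{c}_g(h,k)=\int_M\bigl[\operatorname{tr}(g^{-1}h_0g^{-1}k_0)+c\,\operatorname{tr}_g(h)\operatorname{tr}_g(k)\bigr]\mu_g$. *)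

(* Defs.v *)
From HB Require Import structures.
From mathcomp Require Import all_boot all_order all_algebra.
From mathcomp Require Import all_classical all_reals all_analysis.

Set Implicit Arguments.
Unset Strict Implicit.
Unset Printing Implicit Defensive.

Import Order.TTheory GRing.Theory Num.Theory.
Import numFieldNormedType.Exports.

Local Open Scope classical_set_scope.
Local Open Scope ring_scope.

(* [Ck k U f], for open [U]: all iterated partial derivatives of [f] of order
   at most [k] exist and are continuous on [U]. *)
Fixpoint Ck (R : realType) (m : nat) (V : normedModType R) (k : nat)
    (U : set 'rV[R]_m) (f : 'rV[R]_m -> V) : Prop :=
  (forall x, U x -> {for x, continuous f}) /\
  if k is k'.+1 then
    forall i : 'I_m, (forall x, U x -> derivable f x (delta_mx 0 i)) /\
                     Ck k' U (fun x => 'D_(delta_mx 0 i) f x)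
  else True.

Definition smooth_on (R : realType) (m : nat) (V : normedModType R)
    (U : set 'rV[R]_m) (f : 'rV[R]_m -> V) : Prop := forall k, Ck k U f.

(* The Lebesgue integral over R^m of a nonnegative Borel function, as an
   iterated one-dimensional integral (Tonelli). *)
Fixpoint lebesgue_integral_rV (R : realType) (m : nat) :
    ('rV[R]_m -> \bar R) -> \bar R :=
  match m with
  | 0 => fun f => f 0
  | m'.+1 => fun f =>
      (\int[@lebesgue_measure R]_(t in [set: R])
        @lebesgue_integral_rV R m'
          (fun v : 'rV[R]_m' => f (row_mx (t%:M : 'rV[R]_1) v)))%E
  end.

(* The values of [chart_map] off [chart_dom], and of [chart_inv] off the image
   of [chart_dom], are irrelevant. *)
Record chart (R : realType) (n : nat) (M : topologicalType) := Chart {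
  chart_dom : set M;
  chart_map :> M -> 'rV[R]_n;
  chart_inv : 'rV[R]_n -> M;
  chart_dom_open : open chart_dom;
  chart_cod_open : open (chart_map @` chart_dom);
  chart_mapK : forall p, chart_dom p -> chart_inv (chart_map p) = p;
  chart_map_continuous :
    forall p, chart_dom p -> {for p, continuous chart_map};
  chart_inv_continuous :
    forall p, chart_dom p -> {for chart_map p, continuous chart_inv} }.

Definition smooth_transition (R : realType) (n : nat) (M : topologicalType)
    (a b : chart R n M) : Prop :=
  smooth_on (a @` (chart_dom a `&` chart_dom b)) (b \o chart_inv a).

(* A smooth structure of dimension [n]: a maximal smooth atlas. *)
Record smooth_structure (R : realType) (n : nat) (M : topologicalType) := {
  atlas : set (chart R n M);
  atlas_cover : forall p, exists a, atlas a /\ chart_dom a p;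
  atlas_compatible :
    forall a b, atlas a -> atlas b -> smooth_transition a b;
  atlas_maximal :
    forall a, (forall b, atlas b ->
                 smooth_transition a b /\ smooth_transition b a) -> atlas a }.

(* The Borel sigma-algebra of [M]. *)
Notation borel M := (g_sigma_algebraType (@open M)).

Section Manifold.
Context (R : realType) (n : nat) (M : ptopologicalType).
Variable S : smooth_structure R n M.

Definition chart_at (p : M) : chart R n M := projT1 (cid (atlas_cover S p)).

(* The tangent space at [p] is R^n (row vectors), a tangent vector being given
   by its components in [chart_at p]; a bilinear form on it is given by its
   Gram matrix, (v, w) |-> v *m h p *m w^T.  [change a b p] is the Jacobian
   turning components at [p] in the chart [a] into components in [b]. *)
Definition vector_field := M -> 'rV[R]_n.
Definition tensor2 := M -> 'M[R]_n.

Definition change (a b : chart R n M) (p : M) : 'M[R]_n :=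
  'J (b \o chart_inv a) (a p).

Definition vector_field_in (a : chart R n M) (X : vector_field) (p : M) :
    'rV[R]_n :=
  X p *m change (chart_at p) a p.

Definition tensor2_in (a : chart R n M) (h : tensor2) (p : M) : 'M[R]_n :=
  change a (chart_at p) p *m h p *m (change a (chart_at p) p)^T.

Definition smooth_vector_field (X : vector_field) : Prop :=
  forall a, atlas S a ->
    smooth_on (a @` chart_dom a) (vector_field_in a X \o chart_inv a).

Definition smooth_tensor2 (h : tensor2) : Prop :=
  forall a, atlas S a -> smooth_on (a @` chart_dom a) (tensor2_in a h \o chart_inv a).

Definition symmetric_tensor (h : tensor2) : Prop :=
  smooth_tensor2 h /\ forall p, (h p)^T = h p.

Definition riemannian_metric (g : tensor2) : Prop :=
  symmetric_tensor g /\
  forall p (v : 'rV[R]_n), v != 0 -> 0 < (v *m g p *m v^T) 0 0.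

Definition smooth_map (f : M -> M) : Prop :=
  continuous f /\
  forall a b, atlas S a -> atlas S b ->
    smooth_on (a @` (chart_dom a `&` f @^-1` chart_dom b))
              (b \o f \o chart_inv a).

Record diffeomorphism := {
  diffeo_map :> M -> M;
  diffeo_inv : M -> M;
  diffeo_mapK : cancel diffeo_map diffeo_inv;
  diffeo_invK : cancel diffeo_inv diffeo_map;
  diffeo_map_smooth : smooth_map diffeo_map;
  diffeo_inv_smooth : smooth_map diffeo_inv }.

(* The differential of [f] at [p], acting by v |-> v *m tangent_map f p. *)
Definition tangent_map (f : M -> M) (p : M) : 'M[R]_n :=
  'J (chart_at (f p) \o f \o chart_inv (chart_at p)) (chart_at p p).

Definition pullback (f : M -> M) (h : tensor2) : tensor2 := fun p =>
  tangent_map f p *m h (f p) *m (tangent_map f p)^T.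

Definition pushforward_field (phi : diffeomorphism) (X : vector_field) :
    vector_field := fun q =>
  X (diffeo_inv phi q) *m tangent_map phi (diffeo_inv phi q).

Definition is_flow (X : vector_field) (Fl : R -> M -> M) : Prop :=
  [/\ forall p, Fl 0 p = p,
      forall t, smooth_map (Fl t),
      forall t p, {for t, continuous (fun s => Fl s p)} &
      forall t p, is_derive t (1 : R)
        (fun s => chart_at (Fl t p) (Fl s p)) (X (Fl t p))].

(* Smooth fields on compact manifolds are complete, so the default value is
   not used for them. *)
Definition flow (X : vector_field) : R -> M -> M :=
  @xget (R -> M -> M) (fun _ p => p) [set Fl | is_flow X Fl].

Definition lie_derivative (X : vector_field) (h : tensor2) : tensor2 :=
  fun p => derive1 (fun t : R => pullback (flow X t) h p) 0.

(* In every chart, mu is sqrt (det g_ij) times the Lebesgue measure. *)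
Definition is_riemannian_volume (g : tensor2)
    (mu : {measure set (borel M) -> \bar R}) : Prop :=
  forall a, atlas S a -> forall A : set (borel M), measurable A -> A `<=` chart_dom a ->
    mu A = lebesgue_integral_rV
      ((fun u => (Num.sqrt (\det (tensor2_in a g (chart_inv a u))))%:E)
        \_ (a @` A)).

(* The volume exists and is unique for a Riemannian metric on a compact
   manifold; the zero measure is a default value for other arguments. *)
Definition riemannian_volume (g : tensor2) :
    {measure set (borel M) -> \bar R} :=
  @xget {classic {measure set (borel M) -> \bar R}} mzero
    [set mu | is_riemannian_volume g mu].

Definition trace_wrt (g h : tensor2) (p : M) : R := \tr (invmx (g p) *m h p).

Definition traceless (g h : tensor2) : tensor2 := fun p =>
  h p - (n%:R^-1 * trace_wrt g h p) *: g p.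

Definition Gc (c : R) (g h k : tensor2) : R :=
  \int[riemannian_volume g]_(p in [set: borel M])
    (\tr (invmx (g p) *m traceless g h p *m invmx (g p) *m traceless g k p)
     + c * trace_wrt g h p * trace_wrt g k p).

Definition momentum (c : R) (g k : tensor2) : vector_field -> R :=
  fun X => Gc c g k (lie_derivative X g).

End Manifold.

(* Main.v *)
Require Import Defs.
From HB Require Import structures.
From mathcomp Require Import all_boot all_order all_algebra.
From mathcomp Require Import lra.
From mathcomp Require Import all_classical all_reals all_analysis.

(* Both factors of the pairing are natural under diffeomorphisms.  The flow of
   [phi_* X] is the conjugate by [phi] of the flow of [X], whence
   [L_X (phi^* g) = phi^* (L_(phi_* X) g)]; and since [a \o phi^-1] is a chart
   of the maximal atlas for every chart [a], the volume of [phi^* g] is the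
   image of that of [g] under [phi^-1], without any change of variables.  The
   integrand only involves traces, which are unchanged when all the Gram
   matrices are replaced by [A *m _ *m A^T].
   Flows, volumes and derivatives are total operators with default values, and
   their existence is never proved: each default case matches on both sides.
   What is needed is uniqueness: of flows (Lipschitz estimate, then the
   connectedness of the line), and of volumes (finite cover by charts). *)

Set Implicit Arguments.
Unset Strict Implicit.
Unset Printing Implicit Defensive.

Import Order.TTheory GRing.Theory Num.Theory.
Import numFieldNormedType.Exports.

Local Open Scope classical_set_scope.
Local Open Scope ring_scope.

(** * Functions with continuous partial derivatives *)

(** A first-order expansion determines its linear part, so [diff_unique] identifies [D] with
    ['d f x]. *)
Lemma linear_approx_differentiable (R : realType) (V W : normedModType R)
    (f : V -> W) (D : {linear V -> W}) (x : V) :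
  continuous D ->
  (forall e : R, 0 < e ->
    \forall h \near 0, `|f (h + x) - f x - D h| <= e * `|h|) ->
  differentiable f x.
Proof.
move=> cD H.
have E : f \o shift x = cst (f x) + D +o_ 0 id.
  apply/eqaddoP => e e0; near=> h.
  rewrite -[X in `|X|]/(f (h + x) - (f x + D h)) opprD addrA.
  by near: h; exact: H.
by apply/diff_locallyP; rewrite (diff_unique cD E).
Unshelve. all: by end_near. Qed.

(** Increments of either sign occur below, in a coordinate and in time. Exchanging the endpoints
    negates both sides. *)
Lemma mvt_unordered (R : realType) (f df : R -> R) (a b : R) :
  (forall s, Num.min a b <= s <= Num.max a b -> is_derive s 1 f (df s)) ->
  exists2 s, Num.min a b <= s <= Num.max a b & f b - f a = df s * (b - a).
Proof.
move=> fd.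
have mM : Num.min a b <= Num.max a b by rewrite ge_min le_max lexx.
have fd' s : s \in `](Num.min a b), (Num.max a b)[ -> is_derive s 1 f (df s).
  by rewrite in_itv /= => /andP[/ltW s1 /ltW s2]; apply: fd; rewrite s1.
have cf : {within `[Num.min a b, Num.max a b], continuous f}.
  apply: derivable_within_continuous => s; rewrite in_itv /= => sI.
  by case: (fd s sI).
have [s sI E] := MVT_segment mM fd' cf.
exists s; first by move: sI; rewrite in_itv.
move: E; rewrite /Num.min /Num.max; case: ifP => // _.
by move=> /(congr1 -%R); rewrite opprB -mulrN opprB.
Qed.

Section Increment.
Context (R : realType) (m : nat).
Implicit Types (f : 'rV[R]_m -> R^o) (x y z : 'rV[R]_m).

Lemma derive_line (V : normedModType R) (f : 'rV[R]_m -> V) (w v : 'rV[R]_m) (s : R) :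
  derivable f (s *: v + w) v ->
  is_derive s (1 : R) (fun t => f (t *: v + w)) ('D_v f (s *: v + w)).
Proof.
move=> df.
have E : (fun h : R => h^-1 *: ((fun t => f (t *: v + w)) (h *: (1:R) + s) - f (s *: v + w)))
       = (fun h : R => h^-1 *: (f (h *: v + (s *: v + w)) - f (s *: v + w))).
  by apply/funext => h; rewrite [h *: (1 : R)]mulr1 scalerDl addrA.
by split; rewrite /derivable /derive /= E.
Qed.

Lemma coordinate_mvt f x r (y : 'rV[R]_m) (i : 'I_m) (t : R) :
  (forall w, ball x r w -> derivable f w (delta_mx 0 i)) ->
  ball x r y -> ball x r (t *: delta_mx 0 i + y) ->
  exists2 w, ball x r w &
    f (t *: delta_mx 0 i + y) - f y = t * 'D_(delta_mx 0 i) f w.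
Proof.
move=> df [r0 xy] [_ xty].
set e := delta_mx 0 i : 'rV[R]_m.
(* Balls are cubes: along this segment only coordinate [i] moves, and it stays between its two end
   values. *)
have inb s : Num.min 0 t <= s <= Num.max 0 t -> ball x r (s *: e + y).
  move=> /andP[s1 s2]; split => // a b.
  have := xy a b; have := xty a b; rewrite /ball /= !mxE.
  rewrite /Num.min /Num.max in s1 s2.
  case: (_ && _); last by rewrite !mulr0 !add0r.
  rewrite !mulr1 !ltr_norml => /andP[h1 h2] /andP[h3 h4].
  move: s1 s2; case: ifP => _ s1 s2; apply/andP; split; lra.
have [|s sI E] := @mvt_unordered _ (fun s : R => f (s *: e + y))
    (fun s => 'D_e f (s *: e + y)) 0 t.
  by move=> s sI; apply: derive_line; apply: df; apply: inb.
exists (s *: e + y); first exact: inb.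
by move: E; rewrite scale0r add0r subr0 mulrC.
Qed.

(* Changing one coordinate at a time stays in the ball, which is a cube. *)
Lemma ball_increment f x r y z :
  (forall w i, ball x r w -> derivable f w (delta_mx 0 i)) ->
  ball x r y -> ball x r z ->
  exists2 xi : 'I_m -> 'rV[R]_m, (forall i, ball x r (xi i)) &
    f z - f y = \sum_i (z 0 i - y 0 i) * 'D_(delta_mx 0 i) f (xi i).
Proof.
move=> df xy xz.
pose w k : 'rV[R]_m := \row_j (if (j < k)%N then z 0 j else y 0 j).
have wb k : ball x r (w k).
  case: xy xz => r0 xy [_ xz]; split=> // a b; rewrite (ord1 a) mxE.
  by case: ifP.
have wS (i : 'I_m) : w i.+1 = (z 0 i - y 0 i) *: delta_mx 0 i + w i.
  apply/rowP => j; rewrite !mxE eqxx /= ltnS leq_eqVlt.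
  case: (eqVneq j i) => [->|ji].
    by rewrite eqxx /= ltnn mulr1 subrK.
  by rewrite (_ : (val j == val i) = false) //= ?mulr0 ?add0r //; apply/eqP => /val_inj /eqP; apply/negP.
have H (i : 'I_m) : exists v, ball x r v /\
    f (w i.+1) - f (w i) = (z 0 i - y 0 i) * 'D_(delta_mx 0 i) f v.
  rewrite wS; have [|||v vb E] := @coordinate_mvt f x r (w i) i (z 0 i - y 0 i) => //.
  - by move=> ? ?; apply: df.
  - by rewrite -wS.
  - by exists v.
have [xi xiP] := choice H.
exists xi; first by move=> i; have [] := xiP i.
have wm : w m = z by apply/rowP => j; rewrite mxE ltn_ord.
have w0 : w 0%N = y by apply/rowP => j; rewrite mxE.
rewrite -(eq_bigr _ (fun i _ => (xiP i).2)) -[LHS](_ : f (w m) - f (w 0%N) = _); last by rewrite wm w0.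
by rewrite -(telescope_sumr (fun k => f (w k)) (leq0n m)) big_mkord.
Qed.

(** By [ball_increment] the remainder is a sum of coordinates of [h] times differences between
    partial derivatives at intermediate points and at [x]; continuity makes these differences
    small. *)
Lemma continuous_partials_differentiable f x :
  (\forall y \near x, forall i, derivable f y (delta_mx 0 i)) ->
  (forall i, {for x, continuous (fun y => 'D_(delta_mx 0 i) f y)}) ->
  differentiable f x.
Proof.
move=> df cf.
pose d (h : 'rV[R]_m) : R^o := \sum_i h 0 i * 'D_(delta_mx 0 i) f x.
have dlin : linear d.
  move=> a u v; rewrite /d scaler_sumr -big_split /=; apply: eq_bigr => i _.
  by rewrite !mxE mulrDl scalerAl.
pose dM := GRing.isLinear.Build _ _ _ _ _ dlin.
pose D : {linear _ -> _} := HB.pack d dM.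
have cD : continuous D.
  suff: continuous d by [].
  move=> h; rewrite /d; apply: (@cvg_big _ _ _ _ _ (@add_continuous R^o) _ _ _ _ _ (nbhs_filter h)) => i _.
  by apply: cvgMr_tmp; exact: coord_continuous.
apply: (@linear_approx_differentiable _ _ _ _ D) => // e e0.
  (* The [m] terms then add up to at most [e] times the norm of [h]; the successor keeps the divisor
     positive when [m] is 0. *)
  have : \forall y \near x, forall i, `|'D_(delta_mx 0 i) f x - 'D_(delta_mx 0 i) f y| <= e / m.+1%:R.
    apply: (@filter_forall _ _ (fun i y => `|'D_(delta_mx 0 i) f x - 'D_(delta_mx 0 i) f y| <= e / m.+1%:R) _ (nbhs_filter x)) => i.
    move/cvgrPdist_le : (cf i); apply.
    by rewrite divr_gt0.
  move=> /(filterI df) /nbhs_ballP[r /= r0 rP].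
  apply/nbhs_ballP; exists r => //= h hb.
  have xb : ball x r x by apply: ballxx.
  have xhb : ball x r (h + x).
    move: hb; rewrite -!ball_normE /= sub0r => hb.
    by rewrite opprD addrCA subrr addr0.
  have [|xi xib Exi] := @ball_increment f x r x (h + x) _ xb xhb.
    by move=> w i /rP [].
  rewrite -[X in `|_ - X|]/(d h) Exi /d -sumrB.
  apply: le_trans (ler_norm_sum _ _ _) _.
  apply: (@le_trans _ _ (\sum_(i < m) (e / m.+1%:R * `|h|))).
    apply: ler_sum => i _; rewrite !mxE addrK -mulrBr normrM [leLHS]mulrC.
    apply: ler_pM; rewrite ?normr_ge0 //.
      by have [_ /(_ i)] := rP _ (xib i); rewrite distrC.
    rewrite [leRHS]/Num.Def.normr/= mx_normrE.
    by apply: (le_bigmax _ (fun ij => `|h ij.1 ij.2|) (0, i)).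
  rewrite sumr_const card_ord -[_ *+ m]mulr_natr mulrAC ler_wpM2r //.
  by rewrite -mulrA ger_pMr // mulrC ler_pdivrMr // mul1r ler_nat.
Qed.

End Increment.

Lemma mx_cvg_coord (R : realType) (T : Type) (F : set_system T) m n
    (f : T -> 'M[R]_(m, n)) (l : 'M[R]_(m, n)) :
  Filter F ->
  (forall i j, (fun t => f t i j : R^o) @ F --> (l i j : R^o)) -> f @ F --> l.
Proof.
move=> FF H; apply/cvgrPdist_le => e e0.
have : \forall t \near F, forall ij, `|l ij.1 ij.2 - f t ij.1 ij.2| <= e.
  apply: (@filter_forall _ _ (fun ij t => `|l ij.1 ij.2 - f t ij.1 ij.2| <= e) _ FF) => ij.
  by move/cvgrPdist_le: (H ij.1 ij.2); apply.
apply: filterS => t ft; rewrite [leLHS]/Num.Def.normr/= mx_normrE.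
by rewrite (bigmax_le _ (ltW e0))//= => ij _; rewrite !mxE.
Qed.

Lemma cvg_mulmx2 (R : realType) (T : Type) (F : set_system T) m n p q
    (A : 'M[R]_(m, n)) (B : 'M[R]_(p, q)) (f : T -> 'M[R]_(n, p)) l :
  Filter F -> f @ F --> l -> (fun t => A *m f t *m B) @ F --> A *m l *m B.
Proof.
move=> FF fl; have fc a b : (fun t => f t a b : R^o) @ F --> (l a b : R^o).
  exact: (cvg_comp f (fun C : 'M[R]_(n, p) => C a b) fl (@coord_continuous _ _ _ a b l)).
apply: mx_cvg_coord => i j; rewrite mxE.
under eq_fun do rewrite mxE.
apply: (@cvg_big _ _ _ _ _ (@add_continuous R^o)) => k _.
apply: cvgMr_tmp; rewrite mxE; under eq_fun do rewrite mxE.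
apply: (@cvg_big _ _ _ _ _ (@add_continuous R^o)) => k' _.
by apply: cvgMl_tmp; exact: fc.
Qed.

(** * Calculus of [Ck] functions *)

Section Ck_theory.
Context (R : realType) (m : nat).
Implicit Types (U : set 'rV[R]_m).

Lemma open_near U x (P : 'rV[R]_m -> Prop) :
  open U -> U x -> (forall y, U y -> P y) -> \forall y \near x, P y.
Proof.
by move=> oU Ux UP; have := open_nbhs_nbhs (conj oU Ux); apply: filterS.
Qed.

Lemma Ck_continuous (V : normedModType R) k U (f : 'rV[R]_m -> V) x :
  Ck k U f -> U x -> {for x, continuous f}.
Proof. by case: k => [|k] [cf _] Ux; apply: cf. Qed.

Lemma Ck_pred (V : normedModType R) k U (f : 'rV[R]_m -> V) :
  Ck k.+1 U f -> Ck k U f.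
Proof.
elim: k f => [|k IH] f [cf df]; split=> // i.
by have [dfi Ckf] := df i; split=> //; exact: IH.
Qed.

Lemma Ck_subset (V : normedModType R) k U W (f : 'rV[R]_m -> V) :
  W `<=` U -> Ck k U f -> Ck k W f.
Proof.
move=> WU; elim: k f => [|k IH] f [cf df]; split=> //; try by move=> x /WU; exact: cf.
by move=> i; have [dfi Ckf] := df i; split; [move=> x /WU; exact: dfi | exact: IH].
Qed.

(** Openness turns equality on [U] into equality near each of its points, so the partial derivatives
    agree as well. *)
Lemma eq_Ck (V : normedModType R) k U (f g : 'rV[R]_m -> V) :
  open U -> (forall x, U x -> f x = g x) -> Ck k U f -> Ck k U g.
Proof.
move=> oU; elim: k f g => [|k IH] f g fg [cf df].
  split=> // x Ux; rewrite /prop_for /continuous_at -(fg x Ux).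
  have E : {near x, f =1 g} by apply: (open_near oU Ux); exact: fg.
  exact: cvg_trans (near_eq_cvg E) (cf x Ux).
split.
  move=> x Ux; rewrite /prop_for /continuous_at -(fg x Ux).
  have E : {near x, f =1 g} by apply: (open_near oU Ux); exact: fg.
  exact: cvg_trans (near_eq_cvg E) (cf x Ux).
move=> i; have [dfi Ckf] := df i; split.
  move=> x Ux; apply: near_eq_derivable (dfi x Ux).
  by apply: (open_near oU Ux); exact: fg.
apply: IH Ckf => x Ux; apply: near_eq_derive.
by apply: (open_near oU Ux); exact: fg.
Qed.

(** [Ck] imposes conditions at single points on a function defined everywhere, so [W] may change
    from point to point. Compositions read in charts that vary with the point rely on this. *)
Lemma Ck_local (V : normedModType R) k U (f : 'rV[R]_m -> V) :
  (forall x, U x -> exists W, W x /\ Ck k W f) -> Ck k U f.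
Proof.
elim: k f => [|k IH] f H.
  by split=> // x /H[W [Wx Ckf]]; apply: Ck_continuous Ckf Wx.
split; first by move=> x /H[W [Wx Ckf]]; apply: Ck_continuous Ckf Wx.
move=> i; split; first by move=> x /H[W [Wx [_ /(_ i)[dfi _]]]]; exact: dfi.
by apply: IH => x /H[W [Wx [_ /(_ i)[_ Ckf]]]]; exists W.
Qed.

Lemma Ck_cst (V : normedModType R) k U (a : V) : Ck k U (fun=> a).
Proof.
elim: k a => [|k IH] a; split=> //; try by move=> x _; exact: cst_continuous.
move=> i; split; first by move=> x _; exact: (derivable_cst a x).
rewrite (_ : (fun x => 'D_(delta_mx 0 i) (fun=> a) x) = fun=> 0) //.
by apply/funext => x; exact: (derive_cst a x (delta_mx 0 i)).
Qed.

Lemma CkD (V : normedModType R) k U (f g : 'rV[R]_m -> V) : open U ->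
  Ck k U f -> Ck k U g -> Ck k U (fun x => f x + g x).
Proof.
move=> oU; elim: k f g => [|k IH] f g [cf df] [cg dg]; split=> //;
  try by move=> x Ux; exact: (continuousD (cf x Ux) (cg x Ux)).
move=> i; have [dfi Ckf] := df i; have [dgi Ckg] := dg i; split.
  by move=> x Ux; apply: derivableD; [exact: dfi|exact: dgi].
apply: eq_Ck (IH _ _ Ckf Ckg) => // x Ux.
exact: (esym (deriveD (dfi x Ux) (dgi x Ux))).
Qed.

Lemma CkM k U (f g : 'rV[R]_m -> R^o) : open U ->
  Ck k U f -> Ck k U g -> Ck k U (fun x => f x * g x : R^o).
Proof.
move=> oU; elim: k f g => [|k IH] f g Cf Cg; have [cf df] := Cf; have [cg dg] := Cg; split=> //;
  try by move=> x Ux; exact: (continuousM (cf x Ux) (cg x Ux)).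
move=> i; have [dfi Ckf] := df i; have [dgi Ckg] := dg i; split.
  by move=> x Ux; apply: derivableM; [exact: dfi|exact: dgi].
(* Each term of the Leibniz rule keeps one factor undifferentiated; it is lowered to order [k] for
   the induction hypothesis. *)
have Cf' := Ck_pred Cf; have Cg' := Ck_pred Cg.
apply: eq_Ck (CkD oU (IH _ _ Cf' Ckg) (IH _ _ Cg' Ckf)) => // x Ux.
exact: (esym (deriveM (dfi x Ux) (dgi x Ux))).
Qed.

Lemma Ck_sum (V : normedModType R) (I : Type) (r : seq I) k U (f : I -> 'rV[R]_m -> V) :
  open U -> (forall i, Ck k U (f i)) -> Ck k U (fun x => \sum_(i <- r) f i x).
Proof.
move=> oU Cf; elim: r => [|i r IH].
  by apply: eq_Ck (Ck_cst _ _ 0) => // x _; rewrite big_nil.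
by apply: eq_Ck (CkD oU (Cf i) IH) => // x _; rewrite big_cons.
Qed.

Lemma continuous_rV_coord n (f : 'rV[R]_m -> 'rV[R]_n) x j :
  {for x, continuous f} -> {for x, continuous (fun y => f y 0 j : R^o)}.
Proof.
move=> cf; apply: (@continuous_comp _ _ _ f (fun v => v 0 j)) => //.
exact: coord_continuous.
Qed.

Lemma Ck_coordP n k U (f : 'rV[R]_m -> 'rV[R]_n) : open U ->
  Ck k U f <-> forall j, Ck k U (fun x => f x 0 j : R^o).
Proof.
move=> oU; elim: k f => [|k IH] f; split.
- move=> [cf _] j; split=> // x Ux.
  exact: continuous_rV_coord (cf x Ux).
- move=> H; split=> // x Ux; apply: (mx_cvg_coord (nbhs_filter x)) => a j; rewrite (ord1 a).
  by have [/(_ x Ux)] := H j.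
- move=> [cf df] j; split.
    by move=> x Ux; exact: continuous_rV_coord (cf x Ux).
  move=> i; have [dfi Ckf] := df i; split.
    by move=> x Ux; have /derivable_mxP := dfi x Ux; apply.
  have /IH /(_ j) := Ckf; apply: eq_Ck => // x Ux.
  by rewrite (derive_mx (dfi x Ux)) mxE.
- move=> H.
  have dfi i x : U x -> derivable f x (delta_mx 0 i).
    move=> Ux; apply/derivable_mxP => a j; rewrite (ord1 a).
    by have [_ /(_ i)[/(_ x Ux)]] := H j.
  split.
    move=> x Ux; apply: (mx_cvg_coord (nbhs_filter x)) => a j; rewrite (ord1 a).
    by have [/(_ x Ux)] := H j.
  move=> i; split; first exact: dfi.
  apply/IH => j; have [_ /(_ i)[_]] := H j; apply: eq_Ck => // x Ux.
  by rewrite (derive_mx (dfi i x Ux)) mxE.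
Qed.

Lemma Ck1_differentiable_scalar U (f : 'rV[R]_m -> R^o) x :
  open U -> Ck 1 U f -> U x -> differentiable f x.
Proof.
move=> oU [_ df] Ux; apply: continuous_partials_differentiable.
  by apply: (open_near oU Ux) => y Uy i; have [/(_ y Uy)] := df i.
by move=> i; have [_ [/(_ x Ux)]] := df i.
Qed.

Lemma Ck1_differentiable n U (f : 'rV[R]_m -> 'rV[R]_n) x :
  open U -> Ck 1 U f -> U x -> differentiable f x.
Proof.
move=> oU /(Ck_coordP _ _ oU) Cf Ux.
have -> : f = \sum_(j < n) (fun y => (f y 0 j : R) *: delta_mx 0 j).
  apply/funext => y; rewrite fct_sumE; exact: row_sum_delta.
apply: differentiable_sum => j; apply: differentiableZl.
exact: (Ck1_differentiable_scalar oU (Cf j)).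
Qed.

End Ck_theory.

Lemma derive_comp_coord (R : realType) m p (f : 'rV[R]_m -> 'rV[R]_p)
    (g : 'rV[R]_p -> R^o) x v :
  differentiable f x -> differentiable g (f x) ->
  'D_v (g \o f) x = \sum_j 'D_v (fun y => f y 0 j : R^o) x * 'D_(delta_mx 0 j) g (f x).
Proof.
move=> df dg.
rewrite deriveE; last exact: differentiable_comp.
rewrite diff_comp //= -(deriveE v df) (derive_mx (diff_derivable df)).
rewrite [X in 'd g (f x) X]row_sum_delta linear_sum /=; apply: eq_bigr => j _.
by rewrite linearZ /= -(deriveE _ dg) mxE.
Qed.

(** Induction on the order with [f] fixed and [g] arbitrary: by the chain rule a partial derivative
    of [g \o f] is a sum of products of a partial derivative of [f] with one of [g] composed with
    [f]. *)
Lemma Ck_comp_scalar (R : realType) m p k U W (f : 'rV[R]_m -> 'rV[R]_p)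
    (g : 'rV[R]_p -> R^o) :
  open U -> open W -> (forall x, U x -> W (f x)) ->
  Ck k U f -> Ck k W g -> Ck k U (g \o f).
Proof.
move=> oU oW fUW; elim: k g => [|k IH] g Cf Cg.
  have [cf _] := Cf; have [cg _] := Cg; split=> // x Ux.
  by apply: (@continuous_comp _ _ _ f g); [exact: cf|exact: cg (fUW x Ux)].
(* The chain rule needs differentiability in the full sense, which continuity of the first partial
   derivatives supplies. *)
have C1 n (V : normedModType R) l A (h : 'rV[R]_n -> V) : Ck l.+1 A h -> Ck 1 A h.
  by elim: l => // l IHl /Ck_pred /IHl.
have df x : U x -> differentiable f x by exact: Ck1_differentiable oU (C1 _ _ _ _ _ Cf).
have dg y : W y -> differentiable g y.
  exact: Ck1_differentiable_scalar oW (C1 _ _ _ _ _ Cg).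
split.
  by move=> x Ux; apply: differentiable_continuous; apply: differentiable_comp;
    [exact: df | exact: dg (fUW x Ux)].
move=> i; split.
  by move=> x Ux; apply: diff_derivable; apply: differentiable_comp;
    [exact: df | exact: dg (fUW x Ux)].
have H j : Ck k U (fun x => 'D_(delta_mx 0 i) (fun y => f y 0 j : R^o) x *
      'D_(delta_mx 0 j) g (f x) : R^o).
  apply: CkM => //.
    by have /(Ck_coordP _ _ oU) /(_ j) [_ /(_ i)[_]] := Cf.
  apply: (IH (fun y => 'D_(delta_mx 0 j) g y)); first exact: Ck_pred.
  by have [_ /(_ j)[_]] := Cg.
apply: eq_Ck (Ck_sum (index_enum _) oU H) => // x Ux.
by rewrite (derive_comp_coord _ (df x Ux) (dg _ (fUW x Ux))).
Qed.

Lemma Ck_comp (R : realType) m p q k U W (f : 'rV[R]_m -> 'rV[R]_p)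
    (g : 'rV[R]_p -> 'rV[R]_q) :
  open U -> open W -> (forall x, U x -> W (f x)) ->
  Ck k U f -> Ck k W g -> Ck k U (g \o f).
Proof.
move=> oU oW fUW Cf /(Ck_coordP _ _ oW) Cg; apply/(Ck_coordP _ _ oU) => j.
exact: Ck_comp_scalar (Cg j).
Qed.

(** * Jacobians and tangent maps *)

Section Jacobian.
Context (R : realType).

Lemma near_eq_differentiable (V W : normedModType R) (f g : V -> W) x :
  (\forall y \near x, f y = g y) -> differentiable f x -> differentiable g x.
Proof.
move=> fg df; apply: (@linear_approx_differentiable _ _ _ _ ('d f x)).
  exact: diff_continuous.
move=> e e0; have := diff_locally df => /eqaddoP /(_ e e0) H.
have fg' : \forall h \near 0, f (h + x) = g (h + x).
  have : \forall h \near 0, (fun y => f y = g y) (h + x).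
    by move: fg; rewrite (near_shift 0) subr0.
  by [].
near=> h; rewrite -(near fg' h) // -(nbhs_singleton fg) -addrA -opprD.
by near: h; apply: H.
Unshelve. all: by end_near. Qed.

Lemma jacobianP m n (f : 'rV[R]_m -> 'rV[R]_n) x (A : 'M[R]_(m, n)) :
  differentiable f x -> (forall v, 'D_v f x = v *m A) -> 'J f x = A.
Proof.
move=> df H; apply/row_matrixP => i.
by rewrite !rowE -deriveEjacobian.
Qed.

Lemma near_eq_jacobian m n (f g : 'rV[R]_m -> 'rV[R]_n) x :
  (\forall y \near x, f y = g y) -> differentiable f x -> 'J f x = 'J g x.
Proof.
move=> fg df; have dg := near_eq_differentiable fg df.
by apply: jacobianP => // v; rewrite -deriveEjacobian //; exact: near_eq_derive.
Qed.

(** Vectors are rows, so Jacobians multiply in the order in which the maps are applied. *)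
Lemma jacobian_comp m n p (f : 'rV[R]_m -> 'rV[R]_n) (g : 'rV[R]_n -> 'rV[R]_p) x :
  differentiable f x -> differentiable g (f x) ->
  'J (g \o f) x = 'J f x *m 'J g (f x).
Proof.
move=> df dg; apply: jacobianP; first exact: differentiable_comp.
move=> v; rewrite deriveE; last exact: differentiable_comp.
rewrite diff_comp //= -(deriveE _ df) -(deriveE _ dg).
by rewrite !deriveEjacobian // mulmxA.
Qed.

Lemma is_derive_comp_jacobian m n (u : R -> 'rV[R]_m) (g : 'rV[R]_m -> 'rV[R]_n) (t : R) v :
  is_derive t (1 : R) u v -> differentiable g (u t) ->
  is_derive t (1 : R) (g \o u) (v *m 'J g (u t)).
Proof.
move=> [/derivable1_diffP du uv] dg.
have dgu : differentiable (g \o u) t by exact: differentiable_comp.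
split; first exact/derivable1_diffP.
rewrite deriveE // diff_comp //= -(deriveE _ du) -(deriveE _ dg).
by rewrite deriveEjacobian // uv.
Qed.

End Jacobian.

(** * Charts, smooth maps and tangent maps *)

Section Charts.
Context (R : realType) (n : nat) (M : ptopologicalType).
Variable S : smooth_structure R n M.
Implicit Types (a b : chart R n M) (p : M) (f h : M -> M).

Lemma chart_at_atlas p : atlas S (chart_at S p).
Proof. by rewrite /chart_at; case: cid => a []. Qed.

Lemma chart_at_dom p : chart_dom (chart_at S p) p.
Proof. by rewrite /chart_at; case: cid => a []. Qed.

(** Continuity of [chart_inv] at [a p] does the work: points near [a p] are images of points of the
    domain, and these points lie in [W]. *)
Lemma open_chart_image a (W : set M) : open W -> open (a @` (chart_dom a `&` W)).
Proof.
move=> oW; rewrite openE => _ [p [ap Wp] <-]; rewrite /interior.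
have H1 : \forall y \near a p, (a @` chart_dom a) y.
  by apply: open_nbhs_nbhs; split; [exact: chart_cod_open|exists p].
have H2 : \forall y \near a p, W (chart_inv a y).
  apply: (chart_inv_continuous ap); rewrite chart_mapK //.
  exact: open_nbhs_nbhs.
near=> y.
have [q aq qy] : (a @` chart_dom a) y by near: y.
exists q => //; split => //.
by rewrite -[q](chart_mapK aq) qy; near: y.
Unshelve. all: by end_near. Qed.

Lemma near_chart_inv a p (W : set M) : chart_dom a p -> nbhs p W ->
  \forall y \near a p, W (chart_inv a y).
Proof.
by move=> ap Wp; apply: (chart_inv_continuous ap); rewrite chart_mapK.
Qed.

Lemma near_chart_dom a p : chart_dom a p -> \forall q \near p, chart_dom a q.
Proof. by move=> ap; apply: open_nbhs_nbhs; split=> //; exact: chart_dom_open. Qed.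

Lemma smooth_map_id : smooth_map S (fun p => p).
Proof.
split; first by move=> p.
by move=> a b Aa Ab; exact: (atlas_compatible Aa Ab).
Qed.

Lemma smooth_map_differentiable f a b p : smooth_map S f ->
  atlas S a -> atlas S b -> chart_dom a p -> chart_dom b (f p) ->
  differentiable (b \o f \o chart_inv a) (a p).
Proof.
move=> [cf sf] Aa Ab ap bp.
apply: (Ck1_differentiable (U := a @` (chart_dom a `&` f @^-1` chart_dom b))).
- apply: open_chart_image; apply: open_comp; last exact: chart_dom_open.
  by move=> q _; exact: cf.
- exact: sf.
- by exists p.
Qed.

Lemma near_chart_comp f (T : Type) (G : M -> T) a b p : {for p, continuous f} ->
  chart_dom a p -> chart_dom b (f p) ->
  \forall y \near a p,
    ((G \o chart_inv b) \o (b \o f \o chart_inv a)) y = (G \o f \o chart_inv a) y.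
Proof.
move=> cf ap bp.
have : \forall y \near a p, chart_dom b (f (chart_inv a y)).
  apply: (near_chart_inv (W := f @^-1` chart_dom b) ap).
  exact: cf (near_chart_dom bp).
by apply: filterS => y by_; rewrite /= chart_mapK.
Qed.

(** Inserting [chart_inv b \o b] after [f] leaves the map unchanged near [a p], by continuity of
    [f], and a Jacobian sees no more. Taking the identity for [f] gives a change of source chart. *)
Lemma jacobian_chart_comp f m (G : M -> 'rV[R]_m) a b p : {for p, continuous f} ->
  chart_dom a p -> chart_dom b (f p) ->
  differentiable (b \o f \o chart_inv a) (a p) ->
  differentiable (G \o chart_inv b) (b (f p)) ->
  'J (G \o f \o chart_inv a) (a p) =
  'J (b \o f \o chart_inv a) (a p) *m 'J (G \o chart_inv b) (b (f p)).
Proof.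
move=> cf ap bp df dG.
move: df; set F := b \o f \o chart_inv a => df.
have E : F (a p) = b (f p) by rewrite /F /= chart_mapK.
have dG' : differentiable (G \o chart_inv b) (F (a p)) by rewrite E.
have dGF : differentiable ((G \o chart_inv b) \o F) (a p) by exact: differentiable_comp.
rewrite -[LHS](near_eq_jacobian (near_chart_comp G cf ap bp) dGF).
by rewrite (jacobian_comp df dG') E.
Qed.

Lemma smooth_map_comp f h : smooth_map S f -> smooth_map S h ->
  smooth_map S (h \o f).
Proof.
move=> sf sh; have [cf kf] := sf; have [ch kh] := sh.
split; first by move=> p; apply: continuous_comp; [exact: cf|exact: ch].
move=> a c Aa Ac k; apply: Ck_local => _ [p [ap cp] <-].
(* The composite factors through this chart only near [p]; [Ck_local] reduces smoothness to such a
   neighbourhood. *)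
pose b := chart_at S (f p).
have Ab : atlas S b := chart_at_atlas _.
pose V := f @^-1` (chart_dom b `&` h @^-1` chart_dom c).
have ohc : open (h @^-1` chart_dom c).
  by apply: open_comp; [move=> q _; exact: ch|exact: chart_dom_open].
have oV : open V.
  apply: open_comp; first by move=> q _; exact: cf.
  by apply: openI => //; exact: chart_dom_open.
exists (a @` (chart_dom a `&` V)); split.
  by exists p => //; split=> //; split=> //; exact: chart_at_dom.
have oU := open_chart_image (a := a) oV.
have C : Ck k (a @` (chart_dom a `&` V))
    ((c \o h \o chart_inv b) \o (b \o f \o chart_inv a)).
  apply: (Ck_comp oU (open_chart_image (a := b) ohc)); last exact: kh.
    by move=> _ [q [aq [bq cq]] <-]; exists (f q) => //=; rewrite chart_mapK.
  apply: (Ck_subset _ (kf a b Aa Ab k)).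
  by move=> _ [q [aq [bq cq]] <-]; exists q.
apply: (eq_Ck oU _ C) => _ [q [aq [bq cq]] <-].
by rewrite /= chart_mapK // chart_mapK.
Qed.

Lemma tangent_map_comp f h p : smooth_map S f -> smooth_map S h ->
  tangent_map S (h \o f) p = tangent_map S f p *m tangent_map S h (f p).
Proof.
move=> sf sh; apply: (jacobian_chart_comp (G := chart_at S (h (f p)) \o h)).
- exact: sf.1.
- exact: chart_at_dom.
- exact: chart_at_dom.
- by apply: smooth_map_differentiable => //; [exact: chart_at_atlas..| exact: chart_at_dom|exact: chart_at_dom].
- by apply: smooth_map_differentiable => //; [exact: chart_at_atlas..| exact: chart_at_dom|exact: chart_at_dom].
Qed.

Lemma tangent_map_id p : tangent_map S (fun q => q) p = 1%:M.
Proof.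
have E : \forall y \near chart_at S p p, y = (chart_at S p \o chart_inv (chart_at S p)) y.
  have : \forall y \near chart_at S p p, (chart_at S p @` chart_dom (chart_at S p)) y.
    by apply: open_nbhs_nbhs; split; [exact: chart_cod_open|exists p => //; exact: chart_at_dom].
  by apply: filterS => _ [q qd <-]; rewrite /= chart_mapK.
rewrite -[LHS](near_eq_jacobian E) //.
by apply: jacobianP => // v; rewrite mulmx1; exact: derive_id.
Qed.

Lemma pullback_comp f h (g : tensor2 R n M) : smooth_map S f -> smooth_map S h ->
  pullback S f (pullback S h g) = pullback S (h \o f) g.
Proof.
move=> sf sh; apply/funext => p.
by rewrite /pullback tangent_map_comp // trmx_mul !mulmxA.
Qed.

Definition diffeo_sym (phi : diffeomorphism S) : diffeomorphism S :=
  Build_diffeomorphism (@diffeo_invK _ _ _ _ phi) (@diffeo_mapK _ _ _ _ phi)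
    (diffeo_inv_smooth phi) (diffeo_map_smooth phi).

Lemma tangent_map_diffeoK (phi : diffeomorphism S) p :
  tangent_map S phi p *m tangent_map S (diffeo_inv phi) (phi p) = 1%:M.
Proof.
rewrite -tangent_map_comp; [|exact: diffeo_map_smooth|exact: diffeo_inv_smooth].
rewrite (_ : _ \o _ = fun q => q) ?tangent_map_id //.
by apply/funext => q /=; rewrite diffeo_mapK.
Qed.

Lemma tangent_map_diffeo_unit (phi : diffeomorphism S) p :
  tangent_map S phi p \in unitmx.
Proof. exact: (mulmx1_unit (tangent_map_diffeoK phi p)).1. Qed.

(** The velocity of a curve is known in one chart; this reads it in another chart, or in a chart
    after a diffeomorphism. *)
Lemma is_derive_chart (gamma : R -> M) b m (G : M -> 'rV[R]_m) (t : R) v :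
  {for t, continuous gamma} -> chart_dom b (gamma t) ->
  is_derive t (1 : R) (b \o gamma) v ->
  differentiable (G \o chart_inv b) (b (gamma t)) ->
  is_derive t (1 : R) (G \o gamma) (v *m 'J (G \o chart_inv b) (b (gamma t))).
Proof.
move=> cg bg dv dG.
apply: near_eq_is_derive (is_derive_comp_jacobian dv dG).
have : \forall s \near t, chart_dom b (gamma s) by exact: cg (near_chart_dom bg).
by apply: filterS => s bs; rewrite /= chart_mapK.
Qed.

End Charts.

(** * Uniqueness of flows *)

Lemma Ck1_locally_lipschitz (R : realType) m n (U : set 'rV[R]_m)
    (Y : 'rV[R]_m -> 'rV[R]_n) x : open U -> Ck 1 U Y -> U x ->
  exists r L : R, [/\ 0 < r, 0 < L, ball x r `<=` U &
    forall y z, ball x r y -> ball x r z -> `|Y z - Y y| <= L * `|z - y|].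
Proof.
move=> oU /(Ck_coordP _ _ oU) CY Ux.
(* The sum bounds every partial derivative at [x]; the added 1 is the variation that continuity
   allows on a small ball. *)
pose K : R := \sum_(ij : 'I_m * 'I_n) `|'D_(delta_mx 0 ij.1) (fun y => Y y 0 ij.2 : R^o) x| + 1.
have K0 : 0 < K by rewrite ltr_wpDl // sumr_ge0.
have : \forall y \near x, U y /\ forall ij : 'I_m * 'I_n,
    `|'D_(delta_mx 0 ij.1) (fun y => Y y 0 ij.2 : R^o) y| <= K.
  have nU : \forall y \near x, U y by exact: open_nbhs_nbhs.
  apply: filterI nU _.
  apply: (@filter_forall _ _ (fun (ij : 'I_m * 'I_n) y =>
    `|'D_(delta_mx 0 ij.1) (fun y => Y y 0 ij.2 : R^o) y| <= K) _ (nbhs_filter x)) => -[i j] /=.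
  have [_ /(_ i)[_ [/(_ x Ux) cD _]]] := CY j.
  move/cvgrPdist_le : cD => /(_ 1 ltr01); apply: filterS => y.
  rewrite distrC => Dy.
  have -> : 'D_(delta_mx 0 i) (fun y => Y y 0 j : R^o) y =
     ('D_(delta_mx 0 i) (fun y => Y y 0 j : R^o) y - 'D_(delta_mx 0 i) (fun y => Y y 0 j : R^o) x)
     + 'D_(delta_mx 0 i) (fun y => Y y 0 j : R^o) x by rewrite subrK.
  apply: le_trans (ler_normD _ _) _; rewrite addrC; apply: lerD => //.
  rewrite (bigD1 (i, j)) //= lerDl; exact: sumr_ge0.
move=> /nbhs_ballP[r /= r0 rP].
(* Each of the [m] coordinate increments contributes with slope at most [K]; the successor keeps the
   constant positive when [m] is 0. *)
exists r, (K * m.+1%:R); split => //; first by rewrite mulr_gt0.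
  by move=> y /rP [].
move=> y z xy xz.
rewrite [leLHS]/Num.Def.normr/= mx_normrE bigmax_le //.
  by rewrite !mulr_ge0 // ltW.
move=> [a j] _ /=; rewrite (ord1 a) !mxE.
have [|xi xib ->] := @ball_increment _ _ (fun y => Y y 0 j : R^o) x r y z _ xy xz.
  by move=> w i /rP[Uw _]; have [_ /(_ i)[/(_ w Uw)]] := CY j.
apply: le_trans (ler_norm_sum _ _ _) _.
apply: (@le_trans _ _ (\sum_(i < m) (K * `|z - y|))).
  apply: ler_sum => i _; rewrite normrM [leLHS]mulrC.
  apply: ler_pM; rewrite ?normr_ge0 //.
    by have [_ /(_ (i, j))] := rP _ (xib i).
  rewrite [leRHS]/Num.Def.normr/= mx_normrE.
  have := le_bigmax (0 : R) (fun ij : 'I_1 * 'I_m => `|(z - y) ij.1 ij.2|) (0, i).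
  by rewrite /= !mxE.
rewrite sumr_const card_ord -[_ *+ m]mulr_natr mulrAC ler_wpM2r //.
by rewrite ler_wpM2l ?ler_nat // ltW.
Qed.

(* On [t0 - d, t0 + d] with [2 L d <= 1], the maximum of [|u - v|] is at most
   half of itself. *)
Lemma ode_local_unique (R : realType) n (U : set 'rV[R]_n)
    (Y : 'rV[R]_n -> 'rV[R]_n) (u v : R -> 'rV[R]_n) (t0 : R) :
  open U -> Ck 1 U Y -> U (u t0) -> u t0 = v t0 ->
  (\forall s \near t0, is_derive s (1 : R) u (Y (u s))) ->
  (\forall s \near t0, is_derive s (1 : R) v (Y (v s))) ->
  \forall s \near t0, u s = v s.
Proof.
move=> oU CY Ux uv du dv.
have [r [L [r0 L0 rU lipY]]] := Ck1_locally_lipschitz oU CY Ux.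
have cont (w : R -> 'rV[R]_n) s : is_derive s (1 : R) w (Y (w s)) -> {for s, continuous w}.
  by move=> [/derivable1_diffP /differentiable_continuous].
have nb (w : R -> 'rV[R]_n) : (\forall s \near t0, is_derive s (1 : R) w (Y (w s))) ->
    u t0 = w t0 -> \forall s \near t0, ball (u t0) r (w s).
  move=> dw uw; have /cont cw := nbhs_singleton dw.
  by apply: cw; rewrite -uw; exact: nbhsx_ballx.
have : \forall s \near t0,
   (is_derive s (1 : R) u (Y (u s)) /\ is_derive s (1 : R) v (Y (v s))) /\
   (ball (u t0) r (u s) /\ ball (u t0) r (v s)).
  exact: filterI (filterI du dv) (filterI (nb u du erefl) (nb v dv uv)).
move=> /nbhs_ballP[d' /= d'0 dP].
(* Halving [d'] keeps the closed interval of radius [d] inside the open ball where all the bounds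
   hold. *)
pose d := Num.min (d' / 2) (2 * L)^-1.
have d0 : 0 < d by rewrite lt_min !divr_gt0 //= invr_gt0 mulr_gt0.
have dd' : d < d' by rewrite gt_min; apply/orP; left; lra.
have dL : L * d <= 2^-1.
  have : d <= (2 * L)^-1 by rewrite ge_min lexx orbT.
  by move=> /(ler_wpM2l (ltW L0)); rewrite invfM mulrCA mulfV ?mulr1 ?gt_eqF.
have inB s : t0 - d <= s <= t0 + d -> ball t0 d' s.
  move=> sI; rewrite -ball_normE /= distrC; apply: le_lt_trans dd'.
  by rewrite ler_distl.
have du' s : t0 - d <= s <= t0 + d -> is_derive s (1 : R) u (Y (u s)) by move=> /inB /dP[[]].
have dv' s : t0 - d <= s <= t0 + d -> is_derive s (1 : R) v (Y (v s)) by move=> /inB /dP[[]].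
have ub s : t0 - d <= s <= t0 + d -> ball (u t0) r (u s) by move=> /inB /dP[_ []].
have vb s : t0 - d <= s <= t0 + d -> ball (u t0) r (v s) by move=> /inB /dP[_ []].
have dw s : t0 - d <= s <= t0 + d -> is_derive s (1 : R) (u - v) (Y (u s) - Y (v s)).
  by move=> sI; have ? := du' s sI; have ? := dv' s sI; exact: is_deriveB.
have [c cI cmax] : exists2 c, c \in `[t0 - d, t0 + d] &
    forall s, s \in `[t0 - d, t0 + d] -> `|u s - v s| <= `|u c - v c|.
  apply: (@EVT_max R (fun s => `|u s - v s|)); first lra.
  apply: continuous_in_subspaceT => s; rewrite inE /= in_itv /= => sI.
  have cw : {for s, continuous (u - v)}.
    by case: (dw s sI) => /derivable1_diffP /differentiable_continuous.
  by apply: cvg_norm; exact: cw.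
suff uvc : `|u c - v c| = 0.
  apply/nbhs_ballP; exists d => //= s; rewrite -ball_normE /= distrC => sd.
  apply/eqP; rewrite -subr_eq0 -normr_le0 -uvc; apply: cmax.
  by rewrite in_itv /= -ler_distl ltW.
rewrite in_itv /= in cI.
suff : `|u c - v c| <= L * d * `|u c - v c|.
  move=> H; apply/eqP; rewrite eq_le normr_ge0 andbT.
  have := ler_wpM2r (normr_ge0 (u c - v c)) dL; lra.
have hull s : Num.min t0 c <= s <= Num.max t0 c -> t0 - d <= s <= t0 + d.
  move: cI; rewrite /Num.min /Num.max; case: ifP => _ /andP[c1 c2] /andP[s1 s2]; apply/andP; split; lra.
rewrite [leLHS]/Num.Def.normr/= mx_normrE bigmax_le //.
  by rewrite !mulr_ge0 // ltW.
move=> [a j] _ /=; rewrite (ord1 a) !mxE.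
(* The mean value theorem is applied to each coordinate of [u - v], with an intermediate time that
   depends on the coordinate; the sup norm is recovered coordinate by coordinate. *)
have [|s /hull sI] := @mvt_unordered R (fun s => (u - v) s 0 j)
    (fun s => (Y (u s) - Y (v s)) 0 j) t0 c.
  move=> s /hull /dw [dws <-]; split.
    by have /derivable_mxP := dws; apply.
  by rewrite (derive_mx dws) mxE.
rewrite -[(u - v) c]/(u c - v c) -[(u - v) t0]/(u t0 - v t0) uv subrr !mxE subr0 => ->.
rewrite normrM mulrAC; apply: ler_pM; rewrite ?normr_ge0 //; last first.
  by rewrite ler_distl; move: cI.
apply: (@le_trans _ _ `|Y (u s) - Y (v s)|).
  rewrite [leRHS]/Num.Def.normr/= mx_normrE.
  have := le_bigmax (0 : R) (fun ij : 'I_1 * 'I_n => `|(Y (u s) - Y (v s)) ij.1 ij.2|) (0, j).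
  by rewrite /= !mxE.
apply: le_trans (lipY _ _ (vb s sI) (ub s sI)) _.
by apply: (ler_wpM2l (ltW L0)); apply: cmax; rewrite in_itv.
Qed.

(** * Flows and Lie derivatives on the manifold *)

Section Flows.
Context (R : realType) (n : nat) (M : ptopologicalType).
Variable S : smooth_structure R n M.
Implicit Types (X : vector_field R n M) (Fl : R -> M -> M) (phi : diffeomorphism S).

(** [is_flow] prescribes the velocity in a chart that changes with the point. In one fixed chart the
    trajectory solves an autonomous differential equation, to which local uniqueness applies. *)
Lemma is_flow_chart X Fl (a : chart R n M) t p : is_flow S X Fl ->
  atlas S a -> chart_dom a (Fl t p) ->
  is_derive t (1 : R) (a \o (fun s => Fl s p))
    ((vector_field_in S a X \o chart_inv a) (a (Fl t p))).
Proof.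
move=> [_ _ cFl dFl] Aa at_; rewrite /= chart_mapK //.
apply: (is_derive_chart (cFl t p) (chart_at_dom S _) (dFl t p)).
apply: (smooth_map_differentiable (smooth_map_id S)) => //.
  exact: chart_at_atlas.
exact: chart_at_dom.
Qed.

Lemma closed_agree (T : topologicalType) (u v : T -> M) : hausdorff_space M ->
  continuous u -> continuous v -> closed [set t | u t = v t].
Proof.
move=> hM cu cv t clt; apply: hM => A B uA vB.
have : nbhs t (u @^-1` A `&` v @^-1` B) by apply: filterI; [exact: cu|exact: cv].
by move=> /clt [s [/= suv [sA sB]]]; exists (u s); split=> //; rewrite suv.
Qed.

(** For each [p] the times of agreement contain 0, form an open set by local uniqueness in a chart,
    and a closed one since [M] is Hausdorff. *)
Lemma flow_unique X Fl Fl' : hausdorff_space M -> smooth_vector_field S X ->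
  is_flow S X Fl -> is_flow S X Fl' -> Fl = Fl'.
Proof.
move=> hM sX fl fl'; have [Fl0 _ cFl _] := fl; have [Fl0' _ cFl' _] := fl'.
suff H p : [set t | Fl t p = Fl' t p] = [set: R].
  by apply/funext => t; apply/funext => p; rewrite -[_ = _]/([set t | Fl t p = Fl' t p] t) H.
have cR : connected [set: R] by apply/connected_intervalP => x y _ _ z _.
apply: cR.
- by exists 0; rewrite /= Fl0 Fl0'.
- exists [set t | Fl t p = Fl' t p]; last by rewrite setTI.
  rewrite openE => t /= tE; rewrite /interior.
  pose a := chart_at S (Fl t p).
  have at_ : chart_dom a (Fl t p) := chart_at_dom _ _.
  have at' : chart_dom a (Fl' t p) by rewrite -tE.
  have na : \forall s \near t, chart_dom a (Fl s p) by exact: cFl (near_chart_dom at_).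
  have na' : \forall s \near t, chart_dom a (Fl' s p) by exact: cFl' (near_chart_dom at').
  have Aa : atlas S a := chart_at_atlas _ _.
  have : \forall s \near t, a (Fl s p) = a (Fl' s p).
    apply: (ode_local_unique (u := a \o (fun s => Fl s p))
      (v := a \o (fun s => Fl' s p)) (@chart_cod_open _ _ _ a) (sX a Aa 1%N)).
    + by exists (Fl t p).
    + by rewrite /= tE.
    + by apply: filterS na => s; exact: is_flow_chart.
    + by apply: filterS na' => s; exact: is_flow_chart.
  move=> nE; apply: filterS (filterI nE (filterI na na')) => s [E [as_ as']] /=.
  by rewrite -[LHS](chart_mapK as_) E chart_mapK.
- exists [set t | Fl t p = Fl' t p]; last by rewrite setTI.
  by apply: closed_agree => // t; [exact: cFl|exact: cFl'].
Qed.

Definition conj_flow phi Fl : R -> M -> M := fun t => phi \o Fl t \o diffeo_inv phi.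

(** Conjugation carries a trajectory of [X] to its image under [phi], whose velocity is multiplied
    by [tangent_map S phi]. *)
Lemma is_flow_conj phi X Fl : is_flow S X Fl ->
  is_flow S (pushforward_field phi X) (conj_flow phi Fl).
Proof.
move=> [Fl0 sFl cFl dFl]; split.
- by move=> p; rewrite /conj_flow /= Fl0 diffeo_invK.
- move=> t; apply: smooth_map_comp; first exact: diffeo_inv_smooth.
  by apply: smooth_map_comp => //; exact: diffeo_map_smooth.
- move=> t p; apply: (@continuous_comp _ _ _ (fun s => Fl s (diffeo_inv phi p)) phi).
    exact: cFl.
  exact: (diffeo_map_smooth phi).1.
- move=> t p; rewrite /pushforward_field /conj_flow /= diffeo_mapK.
  set q := diffeo_inv phi p.
  apply: (is_derive_chart (G := chart_at S (phi (Fl t q)) \o phi)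
    (cFl t q) (chart_at_dom S _) (dFl t q)).
  apply: (smooth_map_differentiable (diffeo_map_smooth phi));
    by [exact: chart_at_atlas|exact: chart_at_dom].
Qed.

Lemma pushforward_fieldK phi X :
  pushforward_field (diffeo_sym phi) (pushforward_field phi X) = X.
Proof.
apply/funext => p; rewrite /pushforward_field /= diffeo_mapK.
by rewrite -mulmxA tangent_map_diffeoK mulmx1.
Qed.

Lemma flowE X Fl : hausdorff_space M -> smooth_vector_field S X ->
  is_flow S X Fl -> flow S X = Fl.
Proof.
move=> hM sX fl; rewrite /flow; case: xgetP => [Fl' _ fl'|/(_ Fl)//].
exact: flow_unique hM sX fl' fl.
Qed.

(** Conjugating by [phi] and by its inverse shows that both fields have a flow or neither has; in
    the second case [flow] returns the stationary family on both sides. *)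
Lemma flow_pushforward phi X : hausdorff_space M -> smooth_vector_field S X ->
  (is_flow S X (flow S X) /\
     flow S (pushforward_field phi X) = conj_flow phi (flow S X)) \/
  (flow S X = (fun _ p => p) /\ flow S (pushforward_field phi X) = (fun _ p => p)).
Proof.
move=> hM sX; have [[Fl fl]|nfl] := pselect (exists Fl, is_flow S X Fl).
  left; rewrite (flowE hM sX fl); split=> //.
  rewrite [LHS]/flow; case: xgetP => [Fl' _ fl'|/(_ (conj_flow phi Fl)) []]; last first.
    exact: is_flow_conj.
  (* The chosen flow is brought back by the inverse diffeomorphism, so that uniqueness is invoked
     for [X], whose smoothness is assumed. *)
  have := is_flow_conj (diffeo_sym phi) fl'; rewrite pushforward_fieldK => fl''.
  rewrite -(flow_unique hM sX fl'' fl); apply/funext => t; apply/funext => p.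
  by rewrite /conj_flow /= !diffeo_invK.
right; rewrite /flow; split; case: xgetP => // Fl _ fl; case: nfl.
  by exists Fl.
by exists (conj_flow (diffeo_sym phi) Fl); rewrite -(pushforward_fieldK phi X); exact: is_flow_conj.
Qed.

(** As [A] is invertible, the two difference quotients converge or diverge together. Congruence
    passes to a limit by continuity, and it fixes the default limit, the zero matrix. *)
Lemma derive1_congruence_mx (A : 'M[R]_n) (f : R -> 'M[R]_n) t : A \in unitmx ->
  derive1 (fun s => A *m f s *m A^T) t = A *m derive1 f t *m A^T.
Proof.
move=> Au; have ATu : A^T \in unitmx by rewrite unitmx_tr.
rewrite /derive1; set q := fun h => h^-1 *: (f (h + t) - f t).
have -> : (fun h : R => h^-1 *: (A *m f (h + t) *m A^T - A *m f t *m A^T)) =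
    (fun h => A *m q h *m A^T).
  apply/funext => h; rewrite /q -scalemxAr -scalemxAl.
  by rewrite mulmxBr mulmxBl.
have [/cvg_ex[l ql]|nq] := pselect (cvg (q h @[h --> 0^'])).
  by rewrite (cvg_lim _ ql) //; apply: cvg_lim => //; exact: cvg_mulmx2.
have point0 : point = 0 :> 'M[R]_n by apply/matrixP => i j; rewrite !mxE.
rewrite (dvgP nq) dvgP; first by rewrite [point]point0 mulmx0 mul0mx.
move=> /cvg_ex[l ql]; apply: nq; apply/cvg_ex.
exists (invmx A *m l *m invmx A^T).
have -> : q = fun h => invmx A *m (A *m q h *m A^T) *m invmx A^T.
  by apply/funext => h; rewrite !mulmxA mulVmx // mul1mx -mulmxA mulmxV // mulmx1.
exact: cvg_mulmx2.
Qed.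

Lemma lie_derivative_pullback phi X (g : tensor2 R n M) p :
  hausdorff_space M -> smooth_vector_field S X ->
  lie_derivative S X (pullback S phi g) p =
  pullback S phi (lie_derivative S (pushforward_field phi X) g) p.
Proof.
move=> hM sX; have sphi := diffeo_map_smooth phi.
(* The factor [tangent_map S phi p] does not depend on [t], so differentiating this identity at 0
   gives the claim. *)
suff H t : pullback S (flow S X t) (pullback S phi g) p =
    tangent_map S phi p *m
      pullback S (flow S (pushforward_field phi X) t) g (phi p) *m
      (tangent_map S phi p)^T.
  have E := derive1_congruence_mx
    (fun t => pullback S (flow S (pushforward_field phi X) t) g (phi p)) 0
    (tangent_map_diffeo_unit phi p).
  have E' := congr1 (fun F : R -> 'M[R]_n => derive1 F 0) (funext H).
  have E'' := etrans E' E.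
  exact: E''.
have [[[_ sFl _ _] ->]|[-> ->]] := flow_pushforward phi hM sX; last first.
  rewrite -[RHS]/(pullback S phi (pullback S (fun q => q) g) p).
  by rewrite !pullback_comp //; exact: smooth_map_id.
rewrite -[RHS]/(pullback S phi (pullback S (conj_flow phi (flow S X) t) g) p).
have sconj : smooth_map S (conj_flow phi (flow S X) t).
  apply: smooth_map_comp; first exact: diffeo_inv_smooth.
  exact: smooth_map_comp.
rewrite (pullback_comp g (sFl t) sphi) (pullback_comp g sphi sconj).
(* Both composites are [phi] after the flow of [X]. *)
by congr (pullback S _ g p); apply/funext => q; rewrite /conj_flow /= diffeo_mapK.
Qed.

End Flows.

(** * Volumes *)

Section BijectionIntegral.
Import HBNNSimple.

Lemma nnsfun_comp d1 d2 (T1 : measurableType d1) (T2 : measurableType d2)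
    (R : realType) (f : T1 -> T2) (h : {nnsfun T2 >-> R}) :
  measurable_fun setT f ->
  exists h' : {nnsfun T1 >-> R}, forall x, h' x = h (f x).
Proof.
move=> mf; pose k := h \o f.
have mk : measurable_fun setT k by exact: measurableT_comp.
have fk : finite_set (range k).
  by apply: sub_finite_set (fimfunP h) => _ [x _ <-]; exists (f x).
have k0 x : 0 <= k x by exact: fun_ge0.
pose mk' := isMeasurableFun.Build _ _ _ _ k mk.
pose fk' := FiniteImage.Build _ _ k fk.
pose k0' := isNonNegFun.Build _ _ k k0.
pose h' : {nnsfun T1 >-> R} := HB.pack k mk' fk' k0'.
by exists h'.
Qed.

(* No measurability of [F] is needed: composition with [f] is a bijection
   between simple functions. *)
Lemma integral_pushforward_bij d1 d2 (T1 : measurableType d1)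
    (T2 : measurableType d2) (R : realType) (m : {measure set T1 -> \bar R})
    (f : T1 -> T2) (g : T2 -> T1) (F : T2 -> \bar R) :
  measurable_fun setT f -> measurable_fun setT g -> cancel f g -> cancel g f ->
  (\int[pushforward m f]_x F x = \int[m]_x F (f x))%E.
Proof.
move=> mf mg fK gK.
have H (G : T2 -> \bar R) (G' : T1 -> \bar R) : (forall x, G' x = G (f x)) ->
  [set sintegral (pushforward m f) h | h in [set h : {nnsfun T2 >-> R} | forall x, ((h x)%:E <= G x)%E]] =
  [set sintegral m h | h in [set h : {nnsfun T1 >-> R} | forall x, ((h x)%:E <= G' x)%E]].
  move=> GG'; apply/seteqP; split=> _ [h hG <-].
    have [h' h'E] := nnsfun_comp h mf.
    exists h'; first by move=> x; rewrite h'E GG'; exact: hG.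
    rewrite /sintegral /pushforward; apply: eq_fsbigr => x _; congr (_ * m _)%E.
    by apply/seteqP; split=> y /=; rewrite h'E.
  have [h' h'E] := nnsfun_comp h mg.
  exists h'; first by move=> x; rewrite h'E -[x in G x]gK -GG'; exact: hG.
  rewrite /sintegral /pushforward; apply: eq_fsbigr => x _; congr (_ * m _)%E.
  by apply/seteqP; split=> y /=; rewrite h'E fK.
(* The integral is a difference of suprema over the simple functions below the positive and the
   negative part. *)
rewrite /integral; congr (ereal_sup _ - ereal_sup _)%E; apply: H => x.
  by rewrite !patch_setT !funeposE.
by rewrite !patch_setT !funenegE.
Qed.

End BijectionIntegral.

(** * Riemannian volumes under diffeomorphisms *)

Section Volume.
Context (R : realType) (n : nat) (M : ptopologicalType).
Variable S : smooth_structure R n M.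
Implicit Types (phi : diffeomorphism S) (a : chart R n M) (g : tensor2 R n M).

Lemma open_borel_measurable (A : set (borel M)) : open (A : set M) -> measurable A.
Proof. by move=> oA; apply: sub_sigma_algebra. Qed.

Lemma continuous_borel_measurable (f : M -> M) : continuous f ->
  measurable_fun [set: borel M] (f : borel M -> borel M).
Proof.
move=> cf; apply: (@measurability _ _ (borel M) (borel M) setT f (@open M)) => // _ [A oA <-].
rewrite setTI; apply: open_borel_measurable.
by apply: open_comp => // x _; exact: cf.
Qed.

(** [is_riemannian_volume] fixes the measure of sets lying in a single chart. Compactness gives
    finitely many chart domains, and a Borel set is cut along them one at a time. *)
Lemma riemannian_volume_unique g (mu nu : {measure set (borel M) -> \bar R}) :
  compact [set: M] -> is_riemannian_volume S g mu -> is_riemannian_volume S g nu ->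
  forall A : set (borel M), measurable A -> mu A = nu A.
Proof.
rewrite compact_cover => cM vmu vnu.
have [||s _ cov] := cM M setT (fun p => chart_dom (chart_at S p)).
- by move=> p _; exact: chart_dom_open.
- by move=> p _; exists p => //; exact: chart_at_dom.
have H (r : seq M) (A : set (borel M)) : measurable A ->
    A `<=` [set q | exists2 p, p \in r & chart_dom (chart_at S p) q] -> mu A = nu A.
  elim: r A => [|p r IH] A mA Ar.
    by rewrite (_ : A = set0) ?measure0 //; rewrite -subset0 => q /Ar [].
  have mp : measurable (chart_dom (chart_at S p) : set (borel M)).
    by apply: open_borel_measurable; exact: chart_dom_open.
  rewrite (measureDI mu mA mp) (measureDI nu mA mp); congr (_ + _)%E.
    apply: IH; first exact: measurableD.
    by move=> q [/Ar [p']]; rewrite inE => /predU1P[->//|p'r qp' _]; exists p'.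
  have mAp : measurable (A `&` chart_dom (chart_at S p)) by exact: measurableI.
  have sub : A `&` chart_dom (chart_at S p) `<=` chart_dom (chart_at S p) by move=> q [].
  exact: etrans (vmu _ (chart_at_atlas S p) _ mAp sub)
    (esym (vnu _ (chart_at_atlas S p) _ mAp sub)).
have /finite_seqP[r rE] := finite_fset s.
move=> A mA; apply: (H r) => // q _; have [p ps qp] := cov q I.
by exists p => //; have : [set` r] p by rewrite -rE.
Qed.

Lemma transport_chart_image phi a :
  (a \o diffeo_inv phi) @` (diffeo_inv phi @^-1` chart_dom a) = a @` chart_dom a.
Proof.
apply/seteqP; split=> _ [p ap <-]; first by exists (diffeo_inv phi p).
by exists (phi p); rewrite /= diffeo_mapK.
Qed.

(** The domain is the image of that of [a] under [phi]; writing it as a preimage under the inverse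
    makes it open by continuity. *)
Lemma transport_chart_spec phi a : exists b : chart R n M,
  [/\ chart_dom b = diffeo_inv phi @^-1` chart_dom a,
      chart_map b = a \o diffeo_inv phi & chart_inv b = phi \o chart_inv a].
Proof.
have [cphi _] := diffeo_map_smooth phi; have [cinv _] := diffeo_inv_smooth phi.
unshelve eexists (@Chart R n M (diffeo_inv phi @^-1` chart_dom a)
  (a \o diffeo_inv phi) (phi \o chart_inv a) _ _ _ _ _) => //.
- by apply: open_comp; [move=> p _; exact: cinv|exact: chart_dom_open].
- by rewrite transport_chart_image; exact: chart_cod_open.
- by move=> p ap; rewrite /= chart_mapK // diffeo_invK.
- move=> p ap; apply: continuous_comp; first exact: cinv.
  exact: chart_map_continuous.
- move=> p ap; apply: continuous_comp; first exact: chart_inv_continuous.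
  exact: cphi.
Qed.

(** The transitions between [b] and a chart of the atlas are coordinate expressions of [phi] and of
    its inverse, so maximality of the atlas applies. *)
Lemma transport_chart_atlas phi a b : atlas S a ->
  chart_dom b = diffeo_inv phi @^-1` chart_dom a ->
  chart_map b = a \o diffeo_inv phi -> chart_inv b = phi \o chart_inv a ->
  atlas S b.
Proof.
move=> Aa db mb ib; apply: atlas_maximal => c Ac; split.
- rewrite /smooth_transition.
  have -> : b @` (chart_dom b `&` chart_dom c) = a @` (chart_dom a `&` phi @^-1` chart_dom c).
    rewrite mb db; apply/seteqP; split=> _ [p [ap cp] <-].
      by exists (diffeo_inv phi p) => //; split=> //; rewrite /= diffeo_invK.
    by exists (phi p); rewrite /= diffeo_mapK.
  by rewrite ib; exact: (diffeo_map_smooth phi).2.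
- rewrite /smooth_transition db mb.
  by rewrite setIC setIC; exact: (diffeo_inv_smooth phi).2.
Qed.

(** Since [b \o phi] equals [a], the Jacobian out of [b] at [phi q] is that of [phi] read from [a],
    which factors through [chart_at S q] into a change of chart and the tangent map. *)
Lemma tensor2_in_pullback phi a b g q : atlas S a -> chart_dom a q ->
  chart_map b = a \o diffeo_inv phi -> chart_inv b = phi \o chart_inv a ->
  tensor2_in S b g (phi q) = tensor2_in S a (pullback S phi g) q.
Proof.
move=> Aa aq mb ib; rewrite /tensor2_in /pullback.
have -> : change b (chart_at S (phi q)) (phi q) =
    change a (chart_at S q) q *m tangent_map S phi q.
  rewrite /change mb ib /= diffeo_mapK.
  apply: (jacobian_chart_comp (f := fun p => p) (a := a) (b := chart_at S q)
    (G := chart_at S (phi q) \o phi)) => //.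
  - exact: chart_at_dom.
  - apply: (smooth_map_differentiable (smooth_map_id S)) => //.
      exact: chart_at_atlas.
    exact: chart_at_dom.
  - apply: (smooth_map_differentiable (diffeo_map_smooth phi));
      by [exact: chart_at_atlas|exact: chart_at_dom].
by rewrite trmx_mul !mulmxA.
Qed.

(** The transported chart sends the image of [A] under [phi] to the very set of coordinates that [a]
    gives to [A], and the densities agree there, so the two Lebesgue integrals are identical. *)
Lemma is_riemannian_volume_pullback phi g (mu nu : {measure set (borel M) -> \bar R}) :
  is_riemannian_volume S g mu ->
  (forall A : set (borel M), measurable A -> nu A = mu (diffeo_inv phi @^-1` A)) ->
  is_riemannian_volume S (pullback S phi g) nu.
Proof.
move=> vmu nuE a Aa A mA Aa_; rewrite nuE //.
have [b [db mb ib]] := transport_chart_spec phi a.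
have Ab := transport_chart_atlas Aa db mb ib.
rewrite (vmu b Ab); first last.
- by rewrite db => p /Aa_.
- rewrite -[X in measurable X]setTI.
  exact: (continuous_borel_measurable (diffeo_inv_smooth phi).1).
apply: (congr1 (@lebesgue_integral_rV R n)).
have -> : b @` (diffeo_inv phi @^-1` A) = a @` A.
  rewrite mb; apply/seteqP; split=> _ [p ap <-]; first by exists (diffeo_inv phi p).
  by exists (phi p); rewrite /= diffeo_mapK.
apply/eq_restrictP => u /set_mem [p Ap <-].
have ap := Aa_ _ Ap.
have E := tensor2_in_pullback g Aa ap mb ib.
rewrite ib.
rewrite (_ : (phi \o chart_inv a) (a p) = phi p); last by rewrite /= chart_mapK.
by rewrite E chart_mapK.
Qed.

End Volume.

(** * Equivariance *)

Section Congruence.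
Context (R : realType) (n : nat).
Implicit Types A G H K : 'M[R]_n.

(** A congruence merely conjugates the endomorphism [invmx G *m H] by [A^T]; hence traces of
    products of such endomorphisms are invariant. *)
Lemma invmx_congruence_mul A G H : A \in unitmx -> G \in unitmx ->
  invmx (A *m G *m A^T) *m (A *m H *m A^T) =
  invmx A^T *m (invmx G *m H) *m A^T.
Proof.
move=> Au Gu; have ATu : A^T \in unitmx by rewrite unitmx_tr.
have AGu : A *m G *m A^T \in unitmx by rewrite !unitmx_mul Au Gu.
have E : (A *m G *m A^T) *m (invmx A^T *m (invmx G *m H) *m A^T) = A *m H *m A^T.
  by rewrite !mulmxA mulmxK // mulmxK.
by rewrite -E mulKmx.
Qed.

Lemma mxtrace_conj A H : A \in unitmx -> \tr (invmx A *m H *m A) = \tr H.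
Proof. by move=> Au; rewrite mxtrace_mulC mulmxA mulmxV // mul1mx. Qed.

Lemma mxtrace_congruence A G H : A \in unitmx -> G \in unitmx ->
  \tr (invmx (A *m G *m A^T) *m (A *m H *m A^T)) = \tr (invmx G *m H).
Proof.
move=> Au Gu; rewrite invmx_congruence_mul // mxtrace_conj //.
by rewrite unitmx_tr.
Qed.

Lemma mxtrace_congruence2 A G H K : A \in unitmx -> G \in unitmx ->
  \tr (invmx (A *m G *m A^T) *m (A *m H *m A^T) *m
       invmx (A *m G *m A^T) *m (A *m K *m A^T)) =
  \tr (invmx G *m H *m invmx G *m K).
Proof.
move=> Au Gu; have ATu : A^T \in unitmx by rewrite unitmx_tr.
rewrite -mulmxA !invmx_congruence_mul //.
rewrite -[RHS](mxtrace_conj _ ATu); congr (\tr _).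
by rewrite !mulmxA mulmxK.
Qed.

Lemma posdef_unitmx G :
  (forall v : 'rV[R]_n, v != 0 -> 0 < (v *m G *m v^T) 0 0) -> G \in unitmx.
Proof.
move=> Gpos; rewrite unitmxE unitfE; apply/negP => /det0P[v v0 vG].
by have := Gpos v v0; rewrite vG mul0mx mxE ltxx.
Qed.

End Congruence.

(** * Invariance of the pairing *)

Section Equivariance.
Context (R : realType) (n : nat) (M : ptopologicalType).
Variable S : smooth_structure R n M.
Implicit Types (phi : diffeomorphism S) (g h k : tensor2 R n M).

(** The integrand of [Gc], isolated so that its invariance can be stated point by point. *)
Definition Gc_density (c : R) g h k (p : M) : R :=
  \tr (invmx (g p) *m traceless g h p *m invmx (g p) *m traceless g k p)
  + c * trace_wrt g h p * trace_wrt g k p.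

Lemma trace_wrt_pullback phi g h p : g (phi p) \in unitmx ->
  trace_wrt (pullback S phi g) (pullback S phi h) p = trace_wrt g h (phi p).
Proof.
by move=> gu; apply: mxtrace_congruence => //; exact: tangent_map_diffeo_unit.
Qed.

Lemma traceless_pullback phi g h p : g (phi p) \in unitmx ->
  traceless (pullback S phi g) (pullback S phi h) p =
  pullback S phi (traceless g h) p.
Proof.
move=> gu; rewrite /traceless trace_wrt_pullback // /pullback.
by rewrite mulmxBr mulmxBl -scalemxAr -scalemxAl.
Qed.

Lemma Gc_density_pullback phi c g h k p : g (phi p) \in unitmx ->
  Gc_density c (pullback S phi g) (pullback S phi h) (pullback S phi k) p =
  Gc_density c g h k (phi p).
Proof.
move=> gu; rewrite /Gc_density !trace_wrt_pullback // !traceless_pullback //.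
congr (_ + _); apply: mxtrace_congruence2 => //.
exact: tangent_map_diffeo_unit.
Qed.

Lemma pullback_diffeoK phi g :
  pullback S (diffeo_inv phi) (pullback S phi g) = g.
Proof.
rewrite (pullback_comp g (diffeo_inv_smooth phi) (diffeo_map_smooth phi)).
have -> : phi \o diffeo_inv phi = fun p => p.
  by apply/funext => p /=; rewrite diffeo_invK.
by apply/funext => p; rewrite /pullback tangent_map_id mul1mx trmx1 mulmx1.
Qed.

Lemma pushforward_is_measure d1 d2 (T1 : measurableType d1) (T2 : measurableType d2)
    (m : {measure set T1 -> \bar R}) (f : T1 -> T2) : measurable_fun setT f ->
  exists pf : {measure set T2 -> \bar R}, pf = pushforward m f :> (set T2 -> \bar R).
Proof. by move=> mf; unshelve eexists (pushforward m f : {measure set T2 -> \bar R}). Qed.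

Lemma integral_volume_pullback phi g (F : M -> R) : compact [set: M] ->
  \int[riemannian_volume S (pullback S phi g)]_(p in [set: borel M]) F (phi p) =
  \int[riemannian_volume S g]_(p in [set: borel M]) F p.
Proof.
move=> cM; have [cphi _] := diffeo_map_smooth phi; have [cinv _] := diffeo_inv_smooth phi.
have mphi := continuous_borel_measurable cphi.
have minv := continuous_borel_measurable cinv.
(* Stated for any diffeomorphism, so that a volume can be moved along [phi] or along its inverse. *)
have transport (psi : diffeomorphism S) (h : tensor2 R n M)
    (mu : {measure set (borel M) -> \bar R}) : is_riemannian_volume S h mu ->
  exists2 nu : {measure set (borel M) -> \bar R},
    is_riemannian_volume S (pullback S psi h) nu &
    nu = pushforward mu (diffeo_inv psi : borel M -> borel M) :> (set _ -> _).
  move=> vmu; have mpsi := continuous_borel_measurable (diffeo_inv_smooth psi).1.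
  have [nu nuE] := pushforward_is_measure mu mpsi.
  exists nu => //; apply: is_riemannian_volume_pullback vmu _ => A mA.
  by rewrite nuE.
rewrite /Rintegral; congr fine.
rewrite /riemannian_volume.
case: xgetP => [nu _ vnu|none]; case: xgetP => [mu _ vmu|none'].
- have [pf vpf pfE] := transport phi g mu vmu.
  (* The chosen volume and the image measure agree on measurable sets, which is all that the
     integral sees. *)
  rewrite (eq_measure_integral pf); last first.
    by move=> A mA _; exact: (riemannian_volume_unique cM vnu vpf).
  rewrite pfE (integral_pushforward_bij mu (fun p : borel M => (F (phi p))%:E) minv mphi).
  + by apply: eq_integral => p _; rewrite diffeo_invK.
  + exact: diffeo_invK.
  + exact: diffeo_mapK.
(* If just one of the two tensors had a volume, transport would provide one for the other. *)
- have [pf vpf _] := transport (diffeo_sym phi) _ nu vnu.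
  by move: vpf; rewrite pullback_diffeoK => /(none' pf).
- have [pf vpf _] := transport phi g mu vmu.
  by case: (none pf).
(* Without volumes both choices default to the zero measure. *)
- by rewrite !integral_measure_zero.
Qed.

End Equivariance.

Theorem proposition4p5 (R : realType) (n : nat) (hn : (2 <= n)%N)
    (M : ptopologicalType) (hausdorffM : hausdorff_space M)
    (compactM : compact [set: M]) (connectedM : connected [set: M])
    (S : smooth_structure R n M)
    (c : R) (hc : c != 0)
    (phi : diffeomorphism S)
    (X : vector_field R n M) (hX : smooth_vector_field S X)
    (g k : tensor2 R n M)
    (hg : riemannian_metric S g) (hk : symmetric_tensor S k) :
  momentum S c (pullback S phi g) (pullback S phi k) X =
  momentum S c g k (pushforward_field phi X).
Proof.
(* Positive definiteness makes [g p] invertible, as the trace identities require. *)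
have gu p : g p \in unitmx by apply: posdef_unitmx; exact: hg.2.
pose L := lie_derivative S (pushforward_field phi X) g.
have LE : lie_derivative S X (pullback S phi g) = pullback S phi L.
  by apply/funext => p; exact: lie_derivative_pullback.
(* The right-hand side becomes an integral against the volume of the pulled back metric, where the
   two integrands agree pointwise. *)
have E := integral_volume_pullback phi g (Gc_density c g k L) compactM.
rewrite /momentum LE -[RHS]E; apply: eq_Rintegral => p _.
exact: Gc_density_pullback.
Qed.
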